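(* Let $\mathcal{M}>0$, $l>0$, $r_h=l\sqrt{\mathcal{M}}$, and consider the 3-dimensional non-rotating BTZ metric $$g=-\bar f\,dt^2+\bar f^{-1}dr^2+r^2d\varphi^2,\qquad \bar f=\frac{r^2-r_h^2}{l^2},$$ on the region $r>r_h$. For either choice of sign and any constant $u_0\in\mathbb{R}$, the data $$u=u_0\pm l^{-1}\sqrt{\mathcal{M}}\,t-\ln\sqrt{r^2-r_h^2},\qquad Y=r\,dt\wedge dr,\qquad \xi=\partial_t,\qquad \lambda=\pm l^{-1}\sqrt{\mathcal{M}}$$ (same sign in $u$ and $\lambda$) define a CKY--RS structure $(M,g_{ab},u,Y_{ab},\xi^a,\lambda)$ on it, and the conformal representative $\tilde g=e^{2u}g$ is flat.
   Context: Conformal Killing--Yano (CKY) 2-form on an $n$-dimensional pseudo-Riemannian manifold: a smooth 2-form $Y_{ab}$ with $\nabla_cY_{ab}=g_{ca}\xi_b-g_{cb}\xi_a+z_{abc}$, where $z_{abc}$ is totally antisymmetric and $\xi_a=\frac{1}{n-1}\nabla^bY_{ba}$; $\xi^a=\xi^a[Y]$ is its associated vector field. CKY--RS structure $(M,g_{ab},u,Y_{ab},\xi^a[Y],\lambda)$: $u\in C^\infty(M)$, $\lambda\in\mathbb{R}$, $Y$ is a CKY 2-form of $g$, $\xi=\xi[Y]$, and $\tilde g_{ab}=e^{2u}g_{ab}$ satisfies $\tilde R_{ab}+\frac12\mathcal{L}_{\xi}\tilde g_{ab}=\lambda\tilde g_{ab}$, $\tilde R_{ab}$ being the Ricci tensor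 of $\tilde g$. *)

(* Defs.v *)
From mathcomp Require Import all_boot all_order all_algebra.
From mathcomp Require Import all_classical all_reals all_analysis.
Set Implicit Arguments.
Unset Strict Implicit.
Unset Printing Implicit Defensive.
Import Order.TTheory GRing.Theory Num.Theory numFieldNormedType.Exports.
Local Open Scope classical_set_scope.
Local Open Scope ring_scope.

(* Tensor calculus on n-manifolds of the form M = U / L, where U is an open    *)
(* subset of R^n and L a discrete group of translations preserving U. The      *)
(* group L accounts for periodic coordinates (U = R x I x R and L = 2 pi Z in  *)
(* the last slot give R x I x S^1). Since translations have identity Jacobian, *)
(* tensor fields on M are exactly the arrays of L-periodic functions on U.     *)

Section TensorCalculus.
Context {R : realType} {n : nat}.
Implicit Types (U L : set 'rV[R]_n) (f u : 'rV[R]_n -> R).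
Implicit Types (g h Y : 'rV[R]_n -> 'M[R]_n) (xi : 'rV[R]_n -> 'rV[R]_n).
Implicit Types (x : 'rV[R]_n) (a b c d : 'I_n).

Definition translation_quotient U L : Prop :=
  [/\ open U,
      L 0 /\ (forall v w, L v -> L w -> L (v - w)),
      (exists2 e : R, 0 < e & forall v, L v -> `|v| < e -> v = 0)
    & forall v x, L v -> U x -> U (x + v)].

Definition partial (i : 'I_n) f : 'rV[R]_n -> R := fun x => 'D_(delta_mx 0 i) f x.

Definition iter_partial (s : seq 'I_n) f : 'rV[R]_n -> R := foldr partial f s.

(* C^oo on the open set U: the partial derivatives of all orders exist and are *)
(* continuous at every point of U.                                             *)
Definition smooth_on U f : Prop :=
  forall (s : seq 'I_n) x, U x ->
    {for x, continuous (iter_partial s f)} /\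
    forall i, derivable (iter_partial s f) x (delta_mx 0 i).

Definition smooth_function U L f : Prop :=
  smooth_on U f /\ forall v x, L v -> U x -> f (x + v) = f x.

Definition pseudo_riemannian U L g : Prop :=
  [/\ forall a b, smooth_function U L (fun x => g x a b),
      forall x, U x -> (g x)^T = g x
    & forall x, U x -> g x \in unitmx].

Definition two_form U L Y : Prop :=
  (forall a b, smooth_function U L (fun x => Y x a b)) /\
  (forall x, U x -> (Y x)^T = - Y x).

(* dx^a (x) dx^b, and dx^a /\ dx^b = dx^a (x) dx^b - dx^b (x) dx^a. *)
Definition dtensor a b : 'M[R]_n := delta_mx a b.
Definition dwedge a b : 'M[R]_n := dtensor a b - dtensor b a.

Definition coord_vector a : 'rV[R]_n := delta_mx 0 a.

(* [christoffel g c a b] is Gamma^c_{ab} of the Levi-Civita connection. *)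
Definition christoffel g c a b : 'rV[R]_n -> R := fun x =>
  2^-1 * \sum_d invmx (g x) c d *
    (partial a (fun y => g y d b) x + partial b (fun y => g y d a) x
     - partial d (fun y => g y a b) x).

(* [riemann g d c a b] is R^d_{cab}, the d-component of
   (nabla_a nabla_b - nabla_b nabla_a) d/dx^c. *)
Definition riemann g d c a b : 'rV[R]_n -> R := fun x =>
  partial a (christoffel g d b c) x - partial b (christoffel g d a c) x
  + \sum_e (christoffel g d a e x * christoffel g e b c x
            - christoffel g d b e x * christoffel g e a c x).

(* R_{cb} = R^a_{cab}: positive on round spheres. *)
Definition ricci g c b : 'rV[R]_n -> R := fun x => \sum_a riemann g a c a b x.

Definition flat U g : Prop :=
  forall x, U x -> forall d c a b, riemann g d c a b x = 0.

(* [nabla g Y c a b] is nabla_c Y_{ab}. *)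
Definition nabla g Y c a b : 'rV[R]_n -> R := fun x =>
  partial c (fun y => Y y a b) x
  - \sum_e christoffel g e c a x * Y x e b
  - \sum_e christoffel g e c b x * Y x a e.

(* xi_a[Y] = (n - 1)^-1 nabla^b Y_{ba}, and xi^a[Y] with the index raised. *)
Definition cky_covector g Y : 'rV[R]_n -> 'rV[R]_n := fun x =>
  \row_a ((n%:R - 1)^-1 * \sum_b \sum_c invmx (g x) b c * nabla g Y c b a x).
Definition cky_vector g Y : 'rV[R]_n -> 'rV[R]_n := fun x =>
  \row_a \sum_b invmx (g x) a b * cky_covector g Y x 0 b.

Definition is_CKY U L g Y : Prop :=
  two_form U L Y /\
  exists z : 'I_n -> 'I_n -> 'I_n -> 'rV[R]_n -> R,
    forall x, U x -> forall a b c,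
      [/\ z a b c x = - z b a c x,
          z a b c x = - z a c b x
        & nabla g Y c a b x
          = g x c a * cky_covector g Y x 0 b
            - g x c b * cky_covector g Y x 0 a + z a b c x].

(* (L_xi h)_{ab} for a covariant 2-tensor h. *)
Definition lie_derivative xi h a b : 'rV[R]_n -> R := fun x =>
  \sum_c (xi x 0 c * partial c (fun y => h y a b) x
          + h x c b * partial a (fun y => xi y 0 c) x
          + h x a c * partial b (fun y => xi y 0 c) x).

Definition conformal u g : 'rV[R]_n -> 'M[R]_n := fun x => expR (2 * u x) *: g x.

Definition CKY_RS U L g u Y xi (lambda : R) : Prop :=
  [/\ translation_quotient U L /\ pseudo_riemannian U L g,
      smooth_function U L u,
      is_CKY U L g Y,
      forall x, U x -> xi x = cky_vector g Y x
    & forall x, U x -> forall a b,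
        ricci (conformal u g) a b x
        + 2^-1 * lie_derivative xi (conformal u g) a b x
        = lambda * conformal u g x a b].

End TensorCalculus.

(* Coordinates (t, r, phi) = (x 0 0, x 0 1, x 0 2), phi of period 2 pi. *)
Section BTZ.
Context {R : realType}.
Implicit Types (x : 'rV[R]_3).

Definition btz_region (rh : R) : set 'rV[R]_3 := [set x | rh < x 0 1].

Definition angular_periods : set 'rV[R]_3 :=
  [set v | exists k : int, v = (2 * pi * k%:~R) *: coord_vector 2].

Definition btz_f (l rh : R) x : R := (x 0 1 ^+ 2 - rh ^+ 2) / l ^+ 2.

Definition btz_metric (l rh : R) x : 'M[R]_3 :=
  - btz_f l rh x *: dtensor 0 0 + (btz_f l rh x)^-1 *: dtensor 1 1
  + x 0 1 ^+ 2 *: dtensor 2 2.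

End BTZ.

(* Main.v *)
Require Import Defs.
From mathcomp Require Import all_boot all_order all_algebra.
From mathcomp Require Import all_classical all_reals all_analysis.
From mathcomp Require Import ring lra.
Import Order.TTheory GRing.Theory Num.Theory numFieldNormedType.Exports.
Local Open Scope classical_set_scope.
Local Open Scope ring_scope.
Set Implicit Arguments.
Unset Strict Implicit.
Unset Printing Implicit Defensive.

(** Write [k] for [lambda], so that [rh^2 = k^2 l^4]. Both [g] and
    [e^(2u) g = e^(2 u0 + 2 k t) diag(- 1/l^2, l^2/q^2, r^2/q)], with
    [q = r^2 - rh^2], are of the form [e^(p + m t) diag(F_a(r))], and the
    exponential factor cancels in the Christoffel symbols, which are therefore
    explicit rational functions of [r]. (After rescaling [t] and [r], the second
    metric is the Milne form [e^(2 w s) (- ds^2 + dH^2)] of flat space, [dH^2]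
    being a hyperbolic plane of curvature [- w^2].) Since its Ricci tensor
    vanishes and [d/dt] only sees the factor [e^(2 k t)], the soliton equation
    reduces to [1/2 * 2 k = lambda]. The form [r dt /\ dr] is closed, so the
    totally antisymmetric part [z] of its covariant derivative is [0]. *)

(** * Differentiation and smoothness of elementary functions on an open set *)

Section Elementary.
Context {R : realType} {n : nat}.
Implicit Types (U : set 'rV[R]_n) (f g : 'rV[R]_n -> R) (x v : 'rV[R]_n).

Lemma derive_comp1 (h : R -> R) f x v (dh : R) :
  is_derive (f x) 1 h dh -> differentiable f x ->
  'D_v (h \o f) x = dh * 'D_v f x.
Proof.
move=> hdh df; have dh' : differentiable h (f x).
  by case: hdh => /derivable1_diffP.
rewrite deriveE; last exact: differentiable_comp.
(* The differential of [h] is linear on the line: the scalar ['d f x v], read as itself times [1],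
   comes out and leaves the derivative of [h] in direction [1]. *)
rewrite diff_comp //= (deriveE v df) -[X in 'd h _ X]mulr1 [LHS]linearZ /=.
by have <- := @derive_val _ _ _ _ _ _ _ hdh;
  rewrite (deriveE (1 : R) dh') mulrC.
Qed.

(** Derivatives are local, so a closed formula valid only on the open region may be differentiated
    in place of the original function. *)
Lemma partial_eq_on U f g i x : open U -> (forall y, U y -> f y = g y) ->
  U x -> partial i f x = partial i g x.
Proof.
move=> oU fg Ux; apply: near_eq_derive.
have : nbhs x U by apply: open_nbhs_nbhs.
exact: filterS.
Qed.

Lemma derive_coord x v (i : 'I_n) : 'D_v (fun y : 'rV[R]_n => y 0 i) x = v 0 i.
Proof.
have Dv := @is_derive_id R _ x v.
have := @derive_mx R _ 1 n id x v (@ex_derive _ _ _ _ _ _ _ Dv).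
by rewrite (@derive_val _ _ _ _ _ _ _ Dv) => /matrixP/(_ 0 i); rewrite mxE.
Qed.

(** Smoothness speaks of partial derivatives of every order, so a class stable under [partial] is
    wanted. The conditions on inverse and logarithm keep each member differentiable at every point
    of [U]. *)
Inductive elementary_on U : ('rV[R]_n -> R) -> Prop :=
| elementary_cst c : elementary_on U (fun=> c)
| elementary_coord i : elementary_on U (fun x => x 0 i)
| elementary_add f g : elementary_on U f -> elementary_on U g ->
    elementary_on U (fun x => f x + g x)
| elementary_mul f g : elementary_on U f -> elementary_on U g ->
    elementary_on U (fun x => f x * g x)
| elementary_inv f : elementary_on U f -> (forall x, U x -> f x != 0) ->
    elementary_on U (fun x => (f x)^-1)
| elementary_ln f : elementary_on U f -> (forall x, U x -> 0 < f x) ->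
    elementary_on U (fun x => ln (f x)).

Lemma elementary_opp U f :
  elementary_on U f -> elementary_on U (fun x => - f x).
Proof.
move=> ef; rewrite (_ : (fun x => _) = (fun x => -1 * f x)).
  by apply: elementary_mul => //; apply: elementary_cst.
by apply/funext => x; rewrite mulN1r.
Qed.

Lemma elementary_exp U f m :
  elementary_on U f -> elementary_on U (fun x => f x ^+ m).
Proof.
move=> ef; elim: m => [|m IH]; first exact: elementary_cst.
rewrite (_ : (fun x => _) = (fun x => f x * f x ^+ m)); last first.
  by apply/funext => x; rewrite exprS.
exact: elementary_mul.
Qed.

Lemma elementary_differentiable U f : elementary_on U f ->
  forall x, U x -> differentiable f x.
Proof.
elim=> {f} [c|i|f g _ df _ dg|f g _ df _ dg|f _ df f0|f _ df f0] x Ux.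
- exact: differentiable_cst.
- exact: differentiable_coord.
- by apply: differentiableD; [exact: df|exact: dg].
- by apply: differentiableM; [exact: df|exact: dg].
- by apply: differentiableV; [exact: df|exact: f0].
- refine (@differentiable_comp _ _ R R f (@ln R) x (df _ Ux) _).
  by have [/derivable1_diffP] := is_derive1_ln (f0 _ Ux).
Qed.

(** By induction on the construction, each differentiation rule yields an expression of the same
    class. Equality is claimed on [U] only, where denominators and arguments of [ln] are under
    control. *)
Lemma elementary_partial U f i : elementary_on U f ->
  exists2 h, elementary_on U h & forall x, U x -> partial i f x = h x.
Proof.
elim=> {f} [c|j|f g ef [f' ef' df] eg [g' eg' dg]|
  f g ef [f' ef' df] eg [g' eg' dg]|f ef [f' ef' df] f0|f ef [f' ef' df] f0].
- exists (fun=> 0); first exact: elementary_cst.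
  by move=> x _; apply: derive_cst.
- exists (fun=> (delta_mx 0 i : 'rV[R]_n) 0 j); first exact: elementary_cst.
  by move=> x _; apply: derive_coord.
- exists (fun x => f' x + g' x); first exact: elementary_add.
  move=> x Ux; rewrite -df // -dg //.
  by apply: deriveD; apply: diff_derivable; apply: elementary_differentiable Ux.
- exists (fun x => f x * g' x + g x * f' x).
    by apply: elementary_add; exact: elementary_mul.
  move=> x Ux; rewrite -df // -dg //.
  by apply: deriveM; apply: diff_derivable; apply: elementary_differentiable Ux.
- exists (fun x => (- 1 * ((f x)^-1 * (f x)^-1)) * f' x).
    apply: elementary_mul => //; apply: elementary_mul.
      exact: elementary_cst.
    by apply: elementary_mul; exact: elementary_inv.
  move=> x Ux; rewrite -df // /partial deriveV ?f0 //; last first.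
    by apply: diff_derivable; apply: elementary_differentiable Ux.
  by rewrite -invfM -expr2 mulN1r.
- exists (fun x => (f x)^-1 * f' x).
    apply: elementary_mul => //; apply: elementary_inv => // x Ux.
    by rewrite gt_eqF // f0.
  move=> x Ux; rewrite -df //; apply: derive_comp1.
    exact: is_derive1_ln (f0 _ Ux).
  exact: elementary_differentiable Ux.
Qed.

(** By induction on [s], each iterated partial derivative agrees on [U] with an elementary function.
    The latter is differentiable, and openness of [U] carries continuity and derivability back. *)
Lemma elementary_smooth U f : open U -> elementary_on U f -> smooth_on U f.
Proof.
move=> oU ef s.
have [h eh fh] : exists2 h, elementary_on U h &
    forall x, U x -> iter_partial s f x = h x.
  elim: s => [|i s [h eh fh]] /=; first by exists f.
  have [h' eh' hh'] := elementary_partial i eh; exists h' => // x Ux.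
  by rewrite (partial_eq_on i oU fh Ux) hh'.
move=> x Ux.
have near_fh : \forall y \near x, h y = iter_partial s f y.
  have : nbhs x U by apply: open_nbhs_nbhs.
  by apply: filterS => y Uy; rewrite fh.
have dh := elementary_differentiable eh Ux.
split=> [|i].
  rewrite /prop_for /continuous_at (fh x Ux).
  apply: cvg_trans; last exact: (differentiable_continuous dh).
  exact: near_eq_cvg near_fh.
by apply: near_eq_derivable near_fh _; apply: diff_derivable.
Qed.

Lemma smooth_on_eq U f g : open U -> (forall x, U x -> f x = g x) ->
  smooth_on U f -> smooth_on U g.
Proof.
move=> oU fg sf s x Ux.
have fgs y : U y -> iter_partial s f y = iter_partial s g y.
  elim: s y => [|i s IH] y Uy /=; first exact: fg.
  exact: partial_eq_on Uy.
have near_fg : \forall y \near x, iter_partial s f y = iter_partial s g y.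
  have : nbhs x U by apply: open_nbhs_nbhs.
  exact: filterS.
have [cf df] := sf s x Ux; split=> [|i].
  rewrite /prop_for /continuous_at -(fgs x Ux); apply: cvg_trans cf.
  exact: near_eq_cvg near_fg.
by apply: near_eq_derivable near_fg _; apply: df.
Qed.

(** * Diagonal metrics and coordinate vector fields *)

Lemma invmx_diag_mx (d : 'rV[R]_n) : (forall i, d 0 i != 0) ->
  invmx (diag_mx d) = diag_mx (\row_i (d 0 i)^-1).
Proof.
move=> d0; have dM : diag_mx d *m diag_mx (\row_i (d 0 i)^-1) = 1%:M.
  rewrite mulmx_diag -diag_const_mx; congr diag_mx.
  by apply/rowP => i; rewrite !mxE divff.
have [du _] := mulmx1_unit dM.
by rewrite -[LHS]mulmx1 -dM mulKmx.
Qed.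

Lemma christoffel_diag U (g : 'rV[R]_n -> 'M[R]_n) (G : 'I_n -> 'rV[R]_n -> R) :
  open U -> (forall x, U x -> g x = diag_mx (\row_a G a x)) ->
  (forall x, U x -> forall a, G a x != 0) ->
  forall x, U x -> forall c a b, christoffel g c a b x =
    (2 * G c x)^-1 * ((c == b)%:R * partial a (G c) x
      + (c == a)%:R * partial b (G c) x - (a == b)%:R * partial c (G a) x).
Proof.
move=> oU gG G0 x Ux c a b.
have dg i j k :
    partial k (fun y => g y i j) x = (i == j)%:R * partial k (G i) x.
  rewrite (@partial_eq_on U _ (fun y => G i y *+ (i == j))) //; last first.
    by move=> y Uy; rewrite gG // !mxE.
  case: (i == j); last by rewrite mul0r; apply: derive_cst.
  by rewrite mul1r; apply: partial_eq_on Ux.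
rewrite /christoffel gG // invmx_diag_mx => [|i]; last by rewrite mxE G0.
(* The inverse metric is diagonal, so only [d = c] survives in the sum. *)
rewrite (bigD1 c) //= big1 ?addr0 => [|d dc]; last first.
  by rewrite !mxE eq_sym (negPf dc) mul0r.
rewrite !dg !mxE eqxx mulr1n invfM mulrA; congr (_ * (_ + _ - _)).
Qed.
End Elementary.

Lemma lie_derivative_coord_vector (R : realType) n
    (h : 'rV[R]_n -> 'M[R]_n) i a b x :
  lie_derivative (fun=> coord_vector i) h a b x =
  partial i (fun y => h y a b) x.
Proof.
have dxi j c : partial j (fun=> (coord_vector i : 'rV[R]_n) 0 c) x = 0.
  exact: derive_cst.
rewrite /lie_derivative (bigD1 i) //= big1 => [|c ci]; last first.
  by rewrite (dxi a c) (dxi b c) mxE (negPf ci) andbF mul0r !mulr0 !addr0.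
by rewrite (dxi a i) (dxi b i) mxE !eqxx mul1r !mulr0 !addr0.
Qed.

(** * Componentwise computation with three indices *)

Lemma ord3_ind (P : 'I_3 -> Prop) : P 0 -> P 1 -> P 2 -> forall i, P i.
Proof.
move=> P0 P1 P2 [[|[|[|//]]] lti].
- by rewrite (_ : Ordinal lti = 0) //; apply/val_inj.
- by rewrite (_ : Ordinal lti = 1) //; apply/val_inj.
- by rewrite (_ : Ordinal lti = 2) //; apply/val_inj.
Qed.

Lemma sum_ord3 (V : nmodType) (F : 'I_3 -> V) :
  \sum_(i < 3) F i = F 0 + F 1 + F 2.
Proof.
rewrite !big_ord_recl big_ord0 addr0 addrA.
by congr (F _ + F _ + F _); apply/val_inj.
Qed.

(** After [ord3_ind] has made every index a literal, these rules evaluate the Kronecker deltas, and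
    [val_ord3] lets each [match] on an index reduce. *)
Lemma eq_ord3 : ((0 == 0 :> 'I_3) = true) * ((0 == 1 :> 'I_3) = false) *
  ((0 == 2 :> 'I_3) = false) * ((1 == 0 :> 'I_3) = false) *
  ((1 == 1 :> 'I_3) = true) * ((1 == 2 :> 'I_3) = false) *
  ((2 == 0 :> 'I_3) = false) * ((2 == 1 :> 'I_3) = false) *
  ((2 == 2 :> 'I_3) = true).
Proof. by []. Qed.

Lemma val_ord3 : (((0 : 'I_3) = 0%N :> nat) * ((1 : 'I_3) = 1%N :> nat) *
  ((2 : 'I_3) = 2%N :> nat))%type.
Proof. by []. Qed.

(* The instances of [is_derive] for [f + g] and [f * g] do not match pointwise
   expressions [fun y => f y + g y]; these restatements do. *)
Section DeriveRules.
Context {R : realType}.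
Implicit Types (f g : R -> R) (x : R).

Lemma is_derive_addf f g x df dg : is_derive x 1 f df -> is_derive x 1 g dg ->
  is_derive x 1 (fun y => f y + g y) (df + dg).
Proof. exact: is_deriveD. Qed.

Lemma is_derive_oppf f x df : is_derive x 1 f df ->
  is_derive x 1 (fun y => - f y) (- df).
Proof. exact: is_deriveN. Qed.

Lemma is_derive_mulf f g x df dg : is_derive x 1 f df -> is_derive x 1 g dg ->
  is_derive x 1 (fun y => f y * g y) (f x * dg + g x * df).
Proof. exact: is_deriveM. Qed.

Lemma is_derive_expf f n x df : is_derive x 1 f df ->
  is_derive x 1 (fun y => f y ^+ n) (n%:R * f x ^+ n.-1 * df).
Proof. by move=> fdf; have := is_deriveX n fdf; rewrite fctE. Qed.

Lemma is_derive_invf f x df : f x != 0 -> is_derive x 1 f df ->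
  is_derive x 1 (fun y => (f y)^-1) (- (f x) ^- 2 * df).
Proof.
move=> fx [fdf <-]; apply: DeriveDef; first exact: derivableV.
by rewrite deriveV.
Qed.

Lemma is_derive_idf x : is_derive x 1 (fun y : R => y) 1.
Proof. exact: is_derive_id. Qed.

Lemma is_derive_cstf (c x : R) : is_derive x 1 (fun=> c) 0.
Proof. exact: is_derive_cst. Qed.
End DeriveRules.

Ltac derive_rule := first [exact: is_derive_cstf | exact: is_derive_idf |
  apply: is_derive_addf | apply: is_derive_oppf | apply: is_derive_expf
  | apply: is_derive_mulf | apply: is_derive_invf ].

(** * Metrics that are a function of [r] up to an exponential in [t] *)

Lemma partial_exp_mul (R : realType) (c k : R) (F : R -> R) dF
    (x : 'rV[R]_3) i :
  is_derive (x 0 1) 1 F dF ->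
  partial i (fun y : 'rV[R]_3 => expR (c + k * y 0 0) * F (y 0 1)) x =
  expR (c + k * x 0 0) * ((i == 0)%:R * k * F (x 0 1) + (i == 1)%:R * dF).
Proof.
move=> FdF.
pose E (t : R) := expR (c + k * t).
have dE : is_derive (x 0 0) 1 E (E (x 0 0) * k).
  have d1 : is_derive (x 0 0) 1 (fun t => c + k * t) k.
    by eapply is_derive_eq; [repeat derive_rule|rewrite /GRing.scale /=; ring].
  have := @is_derive1_comp R expR (fun t => c + k * t) (x 0 0) _ _
    (is_derive_expR _) d1.
  exact.
have dx j : differentiable (fun y : 'rV[R]_3 => y 0 j) x.
  exact: differentiable_coord.
have DE : 'D_(delta_mx 0 i) (E \o (fun y : 'rV[R]_3 => y 0 0)) x
    = E (x 0 0) * k * (i == 0)%:R.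
  by rewrite (derive_comp1 _ dE) // derive_coord mxE eqxx eq_sym.
have DF : 'D_(delta_mx 0 i) (F \o (fun y : 'rV[R]_3 => y 0 1)) x
    = dF * (i == 1)%:R.
  by rewrite (derive_comp1 _ FdF) // derive_coord mxE eqxx eq_sym.
have dd (h : R -> R) (dh : R) j : is_derive (x 0 j) 1 h dh ->
    derivable (h \o (fun y : 'rV[R]_3 => y 0 j)) x (delta_mx 0 i).
  move=> [/derivable1_diffP hd _].
  by apply: diff_derivable; apply: differentiable_comp.
have := deriveM (dd _ _ _ dE) (dd _ _ _ FdF).
rewrite DE DF /partial => D; apply: etrans D _; rewrite /= /GRing.scale /= /E.
ring.
Qed.

(** Here [dG i j] is the derivative of the [j]-th diagonal entry in direction [i], divided by the
    exponential. That factor occurs once in the inverse metric and once in each derivative, hence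
    cancels. *)
Lemma christoffel_exp_diag (R : realType) (U : set 'rV[R]_3)
    (g : 'rV[R]_3 -> 'M[R]_3) (p k : R) (F dF : 'I_3 -> R -> R) :
  open U ->
  (forall x, U x ->
    g x = diag_mx (\row_a (expR (p + k * x 0 0) * F a (x 0 1)))) ->
  (forall x, U x -> forall a, F a (x 0 1) != 0) ->
  (forall x, U x -> forall a, is_derive (x 0 1) 1 (F a) (dF a (x 0 1))) ->
  forall x, U x -> forall c a b, let r := x 0 1 in
  let dG i j := (i == 0)%:R * k * F j r + (i == 1)%:R * dF j r in
  christoffel g c a b x = (2 * F c r)^-1 *
    ((c == b)%:R * dG a c + (c == a)%:R * dG b c - (a == b)%:R * dG c a).
Proof.
move=> oU gF F0 FdF x Ux c a b r dG.
rewrite (@christoffel_diag _ _ U g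
  (fun a (y : 'rV[R]_3) => expR (p + k * y 0 0) * F a (y 0 1))) //; last first.
  by move=> y Uy i; rewrite mulf_neq0 ?F0 // gt_eqF // expR_gt0.
rewrite !(partial_exp_mul _ _ _ (FdF x Ux _)) -/r -/(dG _ _).
have E0 : expR (p + k * x 0 0) != 0 by rewrite gt_eqF // expR_gt0.
have := F0 x Ux c; rewrite -/r => Fc0.
rewrite /dG; field.
by rewrite E0 Fc0.
Qed.

(** * The BTZ region and the diagonal entries of both metrics *)

Section BTZ.
Context {R : realType}.
Variables (l rh k : R).
Hypotheses (l_gt0 : 0 < l) (rh_ge0 : 0 <= rh).
(** The choice of sign is hidden in [k]. Only [k ^+ 2] enters this relation, so both signs are
    treated at once. *)
Hypothesis rhk : rh ^+ 2 = k ^+ 2 * l ^+ 4.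
Implicit Types (x : 'rV[R]_3) (r : R).

Let U := @btz_region R rh.

Lemma open_btz_region : open U.
Proof.
have -> : U = (fun x : 'rV[R]_3 => x 0 1) @^-1` [set y | rh < y] by [].
apply: open_comp; last exact: open_gt.
by move=> x _; apply: coord_continuous.
Qed.

Lemma region_r_neq0 x : U x -> x 0 1 != 0.
Proof. by move=> Ux; rewrite gt_eqF // (le_lt_trans rh_ge0). Qed.

Lemma region_q_gt0 x : U x -> 0 < x 0 1 ^+ 2 - rh ^+ 2.
Proof.
move=> Ux; rewrite subr_gt0 ltr_pXn2r // nnegrE //.
exact/ltW/(le_lt_trans rh_ge0).
Qed.

(** Matching on the value in [nat] lets the entry reduce by computation; the last branch is the
    index [2]. *)
Definition btz_diag (a : 'I_3) r : R :=
  match a : nat with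
  | 0 => - ((r ^+ 2 - rh ^+ 2) / l ^+ 2)
  | 1 => ((r ^+ 2 - rh ^+ 2) / l ^+ 2)^-1
  | _ => r ^+ 2
  end.

(* A prime on a function of [r] denotes its derivative. *)
Definition btz_diag' (a : 'I_3) r : R :=
  match a : nat with
  | 0 => - (2 * r / l ^+ 2)
  | 1 => - (2 * r * l ^+ 2 / (r ^+ 2 - rh ^+ 2) ^+ 2)
  | _ => 2 * r
  end.

Lemma btz_metricE x :
  btz_metric l rh x = diag_mx (\row_a btz_diag a (x 0 1)).
Proof.
apply/matrixP => a b; rewrite !mxE.
by elim/ord3_ind: a; elim/ord3_ind: b;
  rewrite !eq_ord3 /btz_diag ?val_ord3 /btz_f /=; ring.
Qed.

(** These are the entries of [btz_diag] divided by [r ^+ 2 - rh ^+ 2], the factor coming from the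
    logarithm in [u]. *)
Definition flat_diag (a : 'I_3) r : R :=
  match a : nat with
  | 0 => - (l ^+ 2)^-1
  | 1 => l ^+ 2 / (r ^+ 2 - rh ^+ 2) ^+ 2
  | _ => r ^+ 2 / (r ^+ 2 - rh ^+ 2)
  end.

Definition flat_diag' (a : 'I_3) r : R :=
  match a : nat with
  | 0 => 0
  | 1 => - (4 * r * l ^+ 2 / (r ^+ 2 - rh ^+ 2) ^+ 3)
  | _ => - (2 * r * rh ^+ 2 / (r ^+ 2 - rh ^+ 2) ^+ 2)
  end.

Lemma btz_diag_neq0 x : U x -> forall a, btz_diag a (x 0 1) != 0.
Proof.
move=> Ux a; have r0 := region_r_neq0 Ux; have := region_q_gt0 Ux.
move=> /lt0r_neq0 q0; have l0 := lt0r_neq0 l_gt0.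
by elim/ord3_ind: a; rewrite /btz_diag val_ord3 /= ?oppr_eq0 ?invr_eq0
  ?mulf_eq0 ?invr_eq0 ?expf_eq0 /= ?negb_or ?q0 ?l0 ?r0.
Qed.

Lemma flat_diag_neq0 x : U x -> forall a, flat_diag a (x 0 1) != 0.
Proof.
move=> Ux a; have r0 := region_r_neq0 Ux; have := region_q_gt0 Ux.
move=> /lt0r_neq0 q0; have l0 := lt0r_neq0 l_gt0.
by elim/ord3_ind: a; rewrite /flat_diag val_ord3 /= ?oppr_eq0 ?invr_eq0
  ?mulf_eq0 ?invr_eq0 ?expf_eq0 /= ?negb_or ?q0 ?l0 ?r0.
Qed.

Lemma btz_diag_derive x : U x -> forall a,
  is_derive (x 0 1) 1 (btz_diag a) (btz_diag' a (x 0 1)).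
Proof.
move=> Ux a; have r0 := region_r_neq0 Ux; have := region_q_gt0 Ux.
move=> /lt0r_neq0 q0; have l0 := lt0r_neq0 l_gt0.
elim/ord3_ind: a; rewrite /btz_diag /btz_diag' val_ord3 /=.
- by eapply is_derive_eq; [repeat derive_rule|rewrite /GRing.scale /=; field].
- eapply is_derive_eq; first (repeat derive_rule;
    rewrite mulf_neq0 ?invr_neq0 ?expf_neq0 //).
  rewrite /GRing.scale /=; field; by rewrite q0.
- by eapply is_derive_eq; [repeat derive_rule|rewrite /GRing.scale /=; ring].
Qed.

Lemma flat_diag_derive x : U x -> forall a,
  is_derive (x 0 1) 1 (flat_diag a) (flat_diag' a (x 0 1)).
Proof.
move=> Ux a; have r0 := region_r_neq0 Ux; have := region_q_gt0 Ux.
move=> /lt0r_neq0 q0; have l0 := lt0r_neq0 l_gt0.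
elim/ord3_ind: a; rewrite /flat_diag /flat_diag' val_ord3 /=.
- by eapply is_derive_eq; [repeat derive_rule|rewrite /GRing.scale /=].
- eapply is_derive_eq; first (repeat derive_rule; rewrite  ?expf_neq0 //).
  rewrite /GRing.scale /=; field; by rewrite q0.
- eapply is_derive_eq; first (repeat derive_rule; rewrite  ?expf_neq0 //).
  rewrite /GRing.scale /=; field; by rewrite q0.
Qed.

(** * The conformal representative and its curvature *)

Definition btz_potential (u0 : R) x : R :=
  u0 + k * x 0 0 - ln (Num.sqrt (x 0 1 ^+ 2 - rh ^+ 2)).

Lemma conformal_btzE (u0 : R) x : U x ->
  conformal (btz_potential u0) (btz_metric l rh) x =
  diag_mx (\row_a (expR (2 * u0 + 2 * k * x 0 0) * flat_diag a (x 0 1))).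
Proof.
move=> Ux; have q_gt0 := region_q_gt0 Ux; have q0 := lt0r_neq0 q_gt0.
have l0 := lt0r_neq0 l_gt0.
(* The factor 2 in the exponent squares the root under the logarithm, so the radial part of the
   conformal factor is rational. *)
have Eu : expR (2 * btz_potential u0 x) =
    expR (2 * u0 + 2 * k * x 0 0) / (x 0 1 ^+ 2 - rh ^+ 2).
  have -> : 2 * btz_potential u0 x = 2 * u0 + 2 * k * x 0 0
      - ln (Num.sqrt (x 0 1 ^+ 2 - rh ^+ 2)) *+ 2.
    by rewrite /btz_potential; ring.
  have s_gt0 : 0 < Num.sqrt (x 0 1 ^+ 2 - rh ^+ 2) by rewrite sqrtr_gt0.
  rewrite expRD expRN -lnXn // sqr_sqrtr ?ltW // lnK //.
rewrite /conformal Eu btz_metricE; apply/matrixP => a b; rewrite !mxE.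
rewrite mulrnAr -mulrA; congr ((_ * _) *+ _).
elim/ord3_ind: a; rewrite /btz_diag /flat_diag val_ord3 /=; field;
  by rewrite ?q0 ?l0.
Qed.

(** The entries with [k] come from differentiating the exponential in [t]. The other nonzero ones
    are the symbols of the surface metric [l^2/q^2 dr^2 + r^2/q dphi^2], of curvature
    [- rh^2/l^2]. *)
Definition flat_christoffel (c a b : 'I_3) r : R :=
  let q := r ^+ 2 - rh ^+ 2 in
  match c : nat, a : nat, b : nat with
  | 0, 0, 0 | 1, 0, 1 | 1, 1, 0 | 2, 0, 2 | 2, 2, 0 => k
  | 0, 1, 1 => k * l ^+ 4 / q ^+ 2
  | 0, 2, 2 => k * l ^+ 2 * r ^+ 2 / q
  | 1, 1, 1 => - (2 * r / q)
  | 1, 2, 2 => r * rh ^+ 2 / l ^+ 2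
  | 2, 1, 2 | 2, 2, 1 => - (rh ^+ 2 / (r * q))
  | _, _, _ => 0
  end.

Definition flat_christoffel' (c a b : 'I_3) r : R :=
  let q := r ^+ 2 - rh ^+ 2 in
  match c : nat, a : nat, b : nat with
  | 0, 1, 1 => - (4 * k * l ^+ 4 * r / q ^+ 3)
  | 0, 2, 2 => - (2 * k * l ^+ 2 * rh ^+ 2 * r / q ^+ 2)
  | 1, 1, 1 => 2 * (r ^+ 2 + rh ^+ 2) / q ^+ 2
  | 1, 2, 2 => rh ^+ 2 / l ^+ 2
  | 2, 1, 2 | 2, 2, 1 =>
      rh ^+ 2 * (3 * r ^+ 2 - rh ^+ 2) / (r ^+ 2 * q ^+ 2)
  | _, _, _ => 0
  end.

Lemma flat_christoffel_derive x c a b : U x ->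
  is_derive (x 0 1) 1 (flat_christoffel c a b)
    (flat_christoffel' c a b (x 0 1)).
Proof.
move=> Ux; have r0 := region_r_neq0 Ux.
have /lt0r_neq0 q0 := region_q_gt0 Ux; have l0 := lt0r_neq0 l_gt0.
elim/ord3_ind: c; elim/ord3_ind: a; elim/ord3_ind: b;
  rewrite /flat_christoffel /flat_christoffel' !val_ord3 /=;
  try exact: is_derive_cstf;
  (eapply is_derive_eq;
   [repeat derive_rule; by rewrite ?mulf_neq0 ?expf_neq0|
    rewrite /GRing.scale /=; field; by rewrite ?q0 ?r0 ?l0]).
Qed.

Lemma christoffel_conformal_btz (u0 : R) x c a b : U x ->
  christoffel (conformal (btz_potential u0) (btz_metric l rh)) c a b x =
  flat_christoffel c a b (x 0 1).
Proof.
move=> Ux; have r0 := region_r_neq0 Ux.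
have /lt0r_neq0 q0 := region_q_gt0 Ux; have l0 := lt0r_neq0 l_gt0.
rewrite (christoffel_exp_diag open_btz_region (@conformal_btzE u0)
  (flat_diag_neq0) (flat_diag_derive)) //.
elim/ord3_ind: c; elim/ord3_ind: a; elim/ord3_ind: b;
  rewrite /flat_christoffel /flat_diag /flat_diag' !eq_ord3 !val_ord3 /=
    ?rhk ?mul0r ?mul1r;
  (* With [rh^2] replaced by [k^2 l^4] in the goal, the nonvanishing of [q] has to be put in the
     same terms for the side conditions of [field]. *)
  rewrite rhk in q0; field; by rewrite ?q0 ?r0 ?l0.
Qed.

(** The symbols depend on [r] alone, so only [partial 1] contributes, and each component is a
    rational identity modulo [rhk]. In [R^1_{212}], for instance, the surface gives
    [- r^2 rh^2 / (l^2 q)], and the product of [Gamma^1_{10}] and [Gamma^0_{22}] gives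
    [k^2 l^2 r^2 / q]. *)
Lemma riemann_conformal_btz (u0 : R) x d c a b : U x ->
  riemann (conformal (btz_potential u0) (btz_metric l rh)) d c a b x = 0.
Proof.
move=> Ux; have r0 := region_r_neq0 Ux.
have /lt0r_neq0 q0 := region_q_gt0 Ux; have l0 := lt0r_neq0 l_gt0.
have dGam i e f h : partial i (christoffel
    (conformal (btz_potential u0) (btz_metric l rh)) e f h) x =
    (i == 1)%:R * flat_christoffel' e f h (x 0 1).
  rewrite (partial_eq_on _ open_btz_region
    (fun y => @christoffel_conformal_btz u0 y e f h)) //.
  have D := flat_christoffel_derive e f h Ux.
  apply: etrans (derive_comp1 (f := fun y : 'rV[R]_3 => y 0 1) (delta_mx 0 i) D
    (differentiable_coord _ _ _)) _.
  by rewrite derive_coord mxE eqxx eq_sym mulrC.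
rewrite /riemann !dGam sum_ord3 !christoffel_conformal_btz //.
by elim/ord3_ind: d; elim/ord3_ind: c; elim/ord3_ind: a; elim/ord3_ind: b;
  rewrite /flat_christoffel /flat_christoffel' !eq_ord3 !val_ord3 /=
    ?rhk ?mul0r ?mul1r;
  rewrite rhk in q0; field; rewrite ?q0 ?r0 ?l0.
Qed.

(** * The BTZ connection and the CKY form *)

Definition btz_christoffel (c a b : 'I_3) r : R :=
  let q := r ^+ 2 - rh ^+ 2 in
  match c : nat, a : nat, b : nat with
  | 0, 0, 1 | 0, 1, 0 => r / q
  | 1, 0, 0 => r * q / l ^+ 4
  | 1, 1, 1 => - (r / q)
  | 1, 2, 2 => - (r * q / l ^+ 2)
  | 2, 1, 2 | 2, 2, 1 => r^-1
  | _, _, _ => 0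
  end.

Lemma christoffel_btz x c a b : U x ->
  christoffel (btz_metric l rh) c a b x = btz_christoffel c a b (x 0 1).
Proof.
move=> Ux; have r0 := region_r_neq0 Ux.
have /lt0r_neq0 q0 := region_q_gt0 Ux; have l0 := lt0r_neq0 l_gt0.
(* The BTZ metric is static: it is the exponential form with both constants in the exponent equal to
   [0]. *)
have btzE y : U y -> btz_metric l rh y =
    diag_mx (\row_i (expR (0 + 0 * y 0 0) * btz_diag i (y 0 1))).
  move=> _; rewrite btz_metricE; congr diag_mx; apply/rowP => i.
  by rewrite !mxE mul0r addr0 expR0 mul1r.
rewrite (christoffel_exp_diag open_btz_region btzE
  (btz_diag_neq0) (btz_diag_derive)) //.
by elim/ord3_ind: c; elim/ord3_ind: a; elim/ord3_ind: b;
  rewrite /btz_christoffel /btz_diag /btz_diag' !eq_ord3 !val_ord3 /=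
    ?mul0r ?mul1r;
  field; rewrite ?q0 ?r0 ?l0.
Qed.

Definition btz_two_form x : 'M[R]_3 := x 0 1 *: dwedge 0 1.

(** This is [d/dt] with its index lowered by the BTZ metric. *)
Definition btz_covector x (a : 'I_3) : R := (a == 0)%:R * - btz_f l rh x.

(** An explicit covector stands on the right because [cky_covector] is itself a trace of this
    derivative; the two are identified afterwards. *)
Lemma nabla_btz_two_form x c a b : U x ->
  nabla (btz_metric l rh) btz_two_form c a b x =
  btz_metric l rh x c a * btz_covector x b
  - btz_metric l rh x c b * btz_covector x a.
Proof.
move=> Ux; have r0 := region_r_neq0 Ux.
have /lt0r_neq0 q0 := region_q_gt0 Ux; have l0 := lt0r_neq0 l_gt0.
have dY : partial c (fun y => btz_two_form y a b) x =
    (c == 1)%:R * (dwedge 0 1 : 'M[R]_3) a b.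
  rewrite (_ : (fun y => _) = (dwedge 0 1 : 'M[R]_3) a b *:
      (fun y : 'rV[R]_3 => y 0 1)); last first.
    by apply/funext => y; rewrite /btz_two_form mxE mulrC.
  apply: etrans (deriveZ _ _) _.
    by apply: diff_derivable; apply: differentiable_coord.
  by rewrite derive_coord [X in _ *: X]mxE eqxx eq_sym [LHS]mulrC.
rewrite /nabla dY !sum_ord3 !christoffel_btz // !btz_metricE
  /btz_two_form /btz_covector /dwedge /dtensor /btz_f !mxE {dY}.
by elim/ord3_ind: c; elim/ord3_ind: a; elim/ord3_ind: b;
  rewrite /btz_christoffel /btz_diag !eq_ord3 !val_ord3 /=;
  field; rewrite ?q0 ?r0 ?l0.
Qed.

Lemma invmx_btz_metric x : U x ->
  invmx (btz_metric l rh x) = diag_mx (\row_a (btz_diag a (x 0 1))^-1).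
Proof.
move=> Ux; rewrite btz_metricE invmx_diag_mx => [|a]; last first.
  by rewrite mxE btz_diag_neq0.
by congr diag_mx; apply/rowP => a; rewrite !mxE.
Qed.

(** Tracing the CKY equation gives [(3 - 1)] times the covector, and the normalisation [(n - 1)^-1]
    removes this factor. *)
Lemma cky_covector_btz x a : U x ->
  cky_covector (btz_metric l rh) btz_two_form x 0 a = btz_covector x a.
Proof.
move=> Ux; have r0 := region_r_neq0 Ux.
have /lt0r_neq0 q0 := region_q_gt0 Ux; have l0 := lt0r_neq0 l_gt0.
rewrite mxE !sum_ord3 !nabla_btz_two_form // invmx_btz_metric //
  !btz_metricE !mxE /btz_covector /btz_f.
by elim/ord3_ind: a; rewrite /btz_diag !eq_ord3 !val_ord3 /=;
  field; rewrite ?q0 ?r0 ?l0.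
Qed.

Lemma cky_vector_btz x : U x ->
  cky_vector (btz_metric l rh) btz_two_form x = coord_vector 0.
Proof.
move=> Ux; have r0 := region_r_neq0 Ux.
have /lt0r_neq0 q0 := region_q_gt0 Ux; have l0 := lt0r_neq0 l_gt0.
apply/rowP => a.
rewrite mxE !sum_ord3 !cky_covector_btz // invmx_btz_metric // !mxE
  /btz_covector /btz_f.
by elim/ord3_ind: a; rewrite /btz_diag !eq_ord3 !val_ord3 /=;
  field; rewrite ?q0 ?r0 ?l0.
Qed.

(** * Periodicity, smoothness and the structural conditions *)

Lemma angular_periods_coord v i : @angular_periods R v -> i != 2 -> v 0 i = 0.
Proof. by case=> m -> i2; rewrite !mxE /= (negPf i2) mulr0. Qed.

Lemma btz_translation_quotient :
  translation_quotient U (@angular_periods R).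
Proof.
split.
- exact: open_btz_region.
- split; first by exists 0; rewrite mulr0 scale0r.
  move=> _ _ [m ->] [m' ->]; exists (m - m').
  by rewrite -scalerBl rmorphB /= mulrBr.
(* Radius [1] isolates [0]: the matrix norm bounds the last coordinate, which for a nonzero period
   is at least [2 pi] in absolute value. *)
- exists 1 => // v [m vm] lt1.
  suff m0 : m = 0 by rewrite vm m0 mulr0 scale0r.
  have : `|v 0 2| < 1 by rewrite (le_lt_trans _ lt1) // [leRHS]mx_normrE
    (le_bigmax _ (fun i => `|v i.1 i.2|) (0, 2)).
  rewrite vm !mxE !eqxx mulr1 !normrM ger0_norm // ger0_norm ?pi_ge0 //.
  move=> lt1'; apply/eqP; apply: contraTT lt1' => m0; rewrite -leNgt.
  have m1 : 1 <= `|m%:~R : R|.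
    by rewrite -intr_norm -[1]/(1%:~R) ler_int -gtz0_ge1 normr_gt0.
  have := @pi_ge2 R; nra.
- move=> v x Lv Ux; rewrite /U /btz_region /= mxE.
  by rewrite (angular_periods_coord Lv) // addr0.
Qed.

(** The periods move only the angle, so independence of the angle gives periodicity. *)
Lemma smooth_function_tr (f : 'rV[R]_3 -> R) : elementary_on U f ->
  (forall x y : 'rV[R]_3, x 0 0 = y 0 0 -> x 0 1 = y 0 1 -> f x = f y) ->
  smooth_function U (@angular_periods R) f.
Proof.
move=> ef fE; split; first exact: elementary_smooth open_btz_region ef.
move=> v x Lv _; apply: fE;
  by rewrite mxE (angular_periods_coord Lv) // addr0.
Qed.

Lemma elementary_horizon :
  elementary_on U (fun x : 'rV[R]_3 => x 0 1 ^+ 2 - rh ^+ 2).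
Proof.
apply: elementary_add; last exact: elementary_cst.
by apply: elementary_exp; apply: elementary_coord.
Qed.

Lemma btz_pseudo_riemannian :
  pseudo_riemannian U (@angular_periods R) (btz_metric l rh).
Proof.
have ef : elementary_on U (fun x : 'rV[R]_3 => (x 0 1 ^+ 2 - rh ^+ 2) / l ^+ 2).
  by apply: elementary_mul; [exact: elementary_horizon|exact: elementary_cst].
split.
- move=> a b.
  rewrite (_ : (fun x => _) =
    (fun x => btz_diag a (x 0 1) *+ (a == b))); last first.
    by apply/funext => x; rewrite btz_metricE !mxE.
  apply: smooth_function_tr; last by move=> x y _ ->.
  case: (a == b); last exact: elementary_cst.
  elim/ord3_ind: a; rewrite /btz_diag val_ord3.
  + exact: elementary_opp.
  + apply: elementary_inv => // x Ux.
    have := btz_diag_neq0 Ux 1.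
    by rewrite /btz_diag val_ord3 invr_eq0.
  + by apply: elementary_exp; apply: elementary_coord.
- by move=> x _; rewrite btz_metricE tr_diag_mx.
- move=> x Ux; rewrite btz_metricE unitmxE det_diag unitfE; apply/prodf_neq0.
  by move=> a _; rewrite mxE btz_diag_neq0.
Qed.

Lemma btz_potential_smooth u0 :
  smooth_function U (@angular_periods R) (btz_potential u0).
Proof.
(* On the region, [ln (Num.sqrt q)] is half of [ln q]; this form of the potential belongs to
   [elementary_on], and [smooth_on_eq] brings smoothness back. *)
have [smooth_v periodic_v] : smooth_function U (@angular_periods R)
    (fun x => u0 + k * x 0 0 + - (2^-1 * ln (x 0 1 ^+ 2 - rh ^+ 2))).
  apply: smooth_function_tr; last by move=> x y -> ->.
  apply: elementary_add.
    apply: elementary_add; first exact: elementary_cst.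
    by apply: elementary_mul; [exact: elementary_cst|exact: elementary_coord].
  apply: elementary_opp; apply: elementary_mul; first exact: elementary_cst.
  apply: elementary_ln; first exact: elementary_horizon.
  by move=> x; exact: region_q_gt0.
split.
  apply: smooth_on_eq smooth_v; first exact: open_btz_region.
  move=> x Ux; rewrite /btz_potential; congr (_ - _).
  have q_gt0 := region_q_gt0 Ux.
  have s_gt0 : 0 < Num.sqrt (x 0 1 ^+ 2 - rh ^+ 2) by rewrite sqrtr_gt0.
  by rewrite -[in LHS](@sqr_sqrtr _ (x 0 1 ^+ 2 - rh ^+ 2)) ?ltW // lnXn //
    -[X in 2^-1 * X = _]mulr_natl mulKf // pnatr_eq0.
move=> v x Lv _; rewrite /btz_potential.
by rewrite !mxE !(angular_periods_coord Lv) // !addr0.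
Qed.

Lemma btz_CKY : is_CKY U (@angular_periods R) (btz_metric l rh) btz_two_form.
Proof.
split; last first.
  exists (fun _ _ _ _ => 0) => x Ux a b c; rewrite oppr0 addr0; split=> //.
  by rewrite nabla_btz_two_form // !cky_covector_btz.
split=> [a b|x _].
  rewrite (_ : (fun x => _) =
    (fun x => x 0 1 * (dwedge 0 1 : 'M[R]_3) a b)); last first.
    by apply/funext => x; rewrite /btz_two_form mxE.
  apply: smooth_function_tr; last by move=> x y _ ->.
  by apply: elementary_mul; [exact: elementary_coord|exact: elementary_cst].
by rewrite /btz_two_form /dwedge /dtensor linearZ linearB /=
  !trmx_delta -scalerN opprB.
Qed.

(** The flow of [d/dt] rescales the exponential and fixes the radial entries, so [d/dt] is a
    homothetic field of the conformal metric. *)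
Lemma lie_derivative_conformal_btz u0 x a b : U x ->
  lie_derivative (fun=> coord_vector 0)
    (conformal (btz_potential u0) (btz_metric l rh)) a b x =
  2 * k * conformal (btz_potential u0) (btz_metric l rh) x a b.
Proof.
move=> Ux; rewrite lie_derivative_coord_vector.
rewrite (partial_eq_on (g := fun y => (expR (2 * u0 + 2 * k * y 0 0)
  * ((a == b)%:R * flat_diag a (y 0 1)))) _ open_btz_region _ Ux); last first.
  move=> y Uy; rewrite conformal_btzE // !mxE.
  by case: (a == b); rewrite ?mul1r // mul0r mulr0.
have := is_derive_mulf (is_derive_cstf (a == b)%:R (x 0 1))
  (flat_diag_derive Ux a).
move=> /partial_exp_mul -> /=.
rewrite conformal_btzE // !mxE.
by case: (a == b) => /=; rewrite ?mulr1n ?mulr0n /=; ring.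
Qed.
End BTZ.

Theorem mainTheorem18 (R : realType) (mass l : R) (mass_gt0 : 0 < mass)
    (l_gt0 : 0 < l) (sgn u0 : R) (sgn_pm1 : sgn = 1 \/ sgn = -1) :
  let rh := l * Num.sqrt mass in
  let g := btz_metric l rh in
  let u := fun x : 'rV[R]_3 =>
    u0 + sgn * (l^-1 * Num.sqrt mass) * x 0 0
    - ln (Num.sqrt (x 0 1 ^+ 2 - rh ^+ 2)) in
  let Y := fun x : 'rV[R]_3 => x 0 1 *: dwedge 0 1 in
  let xi := fun _ : 'rV[R]_3 => coord_vector 0 in
  let lambda := sgn * (l^-1 * Num.sqrt mass) in
  CKY_RS (btz_region rh) angular_periods g u Y xi lambda /\
  flat (btz_region rh) (conformal u g).
Proof.
move=> rh g u Y xi lambda.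
have rh_ge0 : 0 <= rh by rewrite mulr_ge0 ?sqrtr_ge0 // ltW.
(* The sign disappears in the square; both sides are then [l ^+ 2] times the square of
   [Num.sqrt mass]. *)
have rhk : rh ^+ 2 = lambda ^+ 2 * l ^+ 4.
  have l0 := lt0r_neq0 l_gt0.
  by rewrite /rh /lambda; case: sgn_pm1 => ->; field.
have flatg : flat (btz_region rh) (conformal u g).
  move=> x Ux d c a b.
  exact: (riemann_conformal_btz l_gt0 rh_ge0 rhk u0 d c a b Ux).
split=> //; split.
- by split; [exact: btz_translation_quotient|exact: btz_pseudo_riemannian].
- exact: (btz_potential_smooth lambda rh_ge0 u0).
- exact: btz_CKY.
- by move=> x Ux; rewrite [RHS](cky_vector_btz l_gt0 rh_ge0 Ux).
- move=> x Ux a b; rewrite /ricci big1 => [|c _]; last exact: flatg.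
  rewrite add0r [lie_derivative _ _ _ _ _]
    (lie_derivative_conformal_btz lambda l_gt0 rh_ge0 u0 a b Ux).
  by rewrite -mulrA mulKf // pnatr_eq0.
Qed.
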